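(* In the CCSR retransmission protocol described in the context, with at most $\mu\ge 1$ transmission rounds at the MAC layer per ARQ round and non-truncated (unlimited) retransmissions at the ARQ layer, the throughput is $$\eta_\mu=\frac{(1-\alpha)^2}{(1+m)\displaystyle\sum_{J=1}^{\mu}\left(\prod_{j=1}^{J}p_{\epsilon_{J-j}}\right)p_{c_J}\big(J+(\mu-J)\alpha\big)},$$ where $\alpha=\prod_{J=1}^{\mu}p_{\epsilon_J}$ and $p_{\epsilon_0}=1$.
   Context: Chase combining with selective retransmission (CCSR): a packet carrying $k$ information bits is transmitted repeatedly until it is decoded correctly. Each transmission (one MAC-layer round) consists of a full transmission of the $k$ bits followed by selective retransmission of (on average) $mk$ bits, where $m=P(\|H\|^2<\tau)$ is the probability that the norm of a sub-carrier gain $H$ (zero-mean, unit-variance complex Gaussian) falls below the threshold $\tau\ge0$; so each transmission is counted as $I=k(1+m)$ transmitted bits, and $q$ transmissions as $qI$ bits. Transmissions are grouped into consecutive ARQ rounds of $\mu$ transmissions. Within an ARQ round, the $J$-th transmission ($J=1,\dots,\mu$) is decoded jointly with the previous $J-1$ transmissions of that ARQ round; decoding succeeds with probability $p_{c_J}=(1-P_{e_J})^{L_f}$ and fails with probability $p_{\epsilon_J}=1-p_{c_J}$, where $L_f\ge 1$ is the packet length and $0<P_{e_J}<1$ is the bit-error probability of joint detection over $J$ rounds. If all $\mu$ transmissions of an ARQ round fail, all observations are discarded and a new ARQ round is started, with no limit on the number of ARQ rounds. The probabilities of successive failures multiply: for $q\ge 1$, with $\gamma=\lfloor (q-1)/\mu\rfloor$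 and $J=[(q-1)\bmod\mu]+1$, the probability that the packet is decoded correctly for the first time at the $q$-th transmission is $\alpha^{\gamma}\left(\prod_{j=1}^{J}p_{\epsilon_{J-j}}\right)p_{c_J}$, with $p_{\epsilon_0}=1$. The throughput is the ratio $\eta_\mu=k/n_\mu$ of error-free information bits received, $k$, to the expected total number $n_\mu$ of bits transmitted until the packet is decoded correctly. In the paper $P_{e_J}$ is given by the closed-form expression $$P_{e_J}=\sum_{i=0}^{J}\binom{J}{i}\left\{\frac{c}{12}\left(\frac{\rho}{\sigma}\right)^{2(J+i)}\left(e^{-\frac{\tau}{2\rho^2}}\right)^{J-i}\left(1-e^{-\frac{\tau}{2\rho^2}}\right)^{i}+\frac{c}{4}\left(\frac{\rho_1}{\sigma}\right)^{2(J+i)}\left(e^{-\frac{\tau}{2\rho_1^2}}\right)^{J-i}\left(1-e^{-\frac{\tau}{2\rho_1^2}}\right)^{i}\right\},$$ with $\sigma^2=\tfrac12$, noise variance $N_0>0$, modulation constants $c,g>0$, $g_1=\tfrac{4g}{3}$, $\rho=\sqrt{\sigma^2N_0/(g\sigma^2+N_0)}$ and $\rho_1=\sqrt{\sigma^2N_0/(g_1\sigma^2+N_0)}$. *)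

(* Defs.v *)
From HB Require Import structures.
From mathcomp Require Import all_boot all_order all_algebra.
From mathcomp Require Import all_classical all_reals all_analysis.
From mathcomp Require Import complex.
Set Implicit Arguments.
Unset Strict Implicit.
Unset Printing Implicit Defensive.
Import Order.TTheory GRing.Theory Num.Theory.
Local Open Scope classical_set_scope.
Local Open Scope ring_scope.

(* MathComp-Analysis; [complex R] and its modulus [Normc.normc] are those of
   mathcomp-real-closed. *)

(* sigma^2 = 1/2 is the variance of each real component of a sub-carrier gain. *)
Definition gain_sd (R : realType) : R := Num.sqrt (2%:R^-1).

(* Circularly symmetric complex Gaussian with mean 0 and E|H|^2 = 1: the real
   and imaginary parts are independent, each N(0, 1/2).  The second argument of
   [normal_prob] is the standard deviation. *)
Definition std_complex_gaussian (R : realType) (d : measure_display)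
    (Omega : measurableType d) (P : probability Omega R)
    (H : Omega -> complex R) : Prop :=
  [/\ measurable_fun setT (fun w => complex.Re (H w)),
      measurable_fun setT (fun w => complex.Im (H w)) &
      forall A B : set R, measurable A -> measurable B ->
        P [set w | A (complex.Re (H w)) /\ B (complex.Im (H w))] =
        (normal_prob 0 (gain_sd R) A * normal_prob 0 (gain_sd R) B)%E].

Definition selective_prob (R : realType) (d : measure_display)
    (Omega : measurableType d) (P : probability Omega R)
    (H : Omega -> complex R) (tau : R) : R :=
  fine (P [set w | Normc.normc (H w) ^+ 2 < tau]).

(* sqrt(sigma^2 N0 / (g sigma^2 + N0)): rho at g, rho_1 at 4 g / 3. *)
Definition rho (R : realType) (N0 g : R) : R :=
  Num.sqrt (gain_sd R ^+ 2 * N0 / (g * gain_sd R ^+ 2 + N0)).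

Definition ber_term (R : realType) (tau r : R) (J i : nat) : R :=
  (r / gain_sd R) ^+ (2 * (J + i))
  * expR (- (tau / (2%:R * r ^+ 2))) ^+ (J - i)
  * (1 - expR (- (tau / (2%:R * r ^+ 2)))) ^+ i.

Definition bit_error_prob (R : realType) (tau N0 c g : R) (J : nat) : R :=
  \sum_(0 <= i < J.+1) 'C(J, i)%:R *
    (c / 12%:R * ber_term tau (rho N0 g) J i
     + c / 4%:R * ber_term tau (rho N0 (4%:R * g / 3%:R)) J i).

Section Protocol.
Variables (R : realType) (Pe : nat -> R) (Lf mu : nat).

Definition p_corr (J : nat) : R := (1 - Pe J) ^+ Lf.

Definition p_err (J : nat) : R := if J is 0 then 1 else 1 - p_corr J.

Definition arq_fail : R := \prod_(1 <= J < mu.+1) p_err J.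

(* Probability that, inside one ARQ round, the first success is the J-th
   transmission. *)
Definition round_weight (J : nat) : R :=
  (\prod_(1 <= j < J.+1) p_err (J - j)%N) * p_corr J.

(* Transmissions are numbered from 1. *)
Definition first_success_prob (q : nat) : R :=
  arq_fail ^+ ((q - 1) %/ mu)%N * round_weight ((q - 1) %% mu).+1.

End Protocol.

Section Process.
Variables (R : realType) (d : measure_display) (Omega : measurableType d).

(* [D q] is the event that decoding is successful at transmission q >= 1;
   [D 0] is irrelevant. *)
Definition first_success (D : nat -> set Omega) (q : nat) : set Omega :=
  [set w | D q w /\ forall i, (0 < i < q)%N -> ~ D i w].

(* The number of transmissions performed until the packet is decoded; it is
   +oo on outcomes where decoding never succeeds. *)
Definition nb_transmissions (D : nat -> set Omega) (w : Omega) : \bar R :=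
  ereal_inf [set (q%:R)%:E | q in [set q : nat | (0 < q)%N /\ D q w]].

(* [decoding_process P Pe Lf mu D]: the law of the index of the first
   successful transmission, with no bound on the number of ARQ rounds. *)
Definition decoding_process (P : probability Omega R) (Pe : nat -> R)
    (Lf mu : nat) (D : nat -> set Omega) : Prop :=
  (forall q, (0 < q)%N -> measurable (D q)) /\
  (forall q, (0 < q)%N ->
     P (first_success D q) = (first_success_prob Pe Lf mu q)%:E).

(* n_mu, each transmission being counted as k (1 + m) bits. *)
Definition expected_bits (P : probability Omega R) (k : nat) (m : R)
    (D : nat -> set Omega) : \bar R :=
  (\int[P]_w ((k%:R * (1 + m))%R%:E * nb_transmissions D w))%E.

Definition throughput (P : probability Omega R) (k : nat) (m : R)
    (D : nat -> set Omega) : \bar R :=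
  ((k%:R)%R%:E / expected_bits P k m D)%E.

End Process.

(* Main.v *)
Require Import Defs.
From mathcomp Require Import all_boot all_order all_algebra.
From mathcomp Require Import all_classical all_reals all_analysis.
From mathcomp Require Import complex.
From mathcomp Require Import measurable_realfun ring.
Import Order.TTheory GRing.Theory Num.Theory.
Import numFieldNormedType.Exports.
Local Open Scope classical_set_scope.
Local Open Scope ring_scope.

(* The number N of transmissions equals q + 1 on the event A q that decoding
   first succeeds at transmission q + 1.  Writing q = b mu + j, the event A q
   has probability alpha^b w_j, where w_j = round_weight (j + 1).  The w_j
   telescope to 1 - alpha, so the A q exhaust the space up to a null set and
   E[N] = \sum_b \sum_j (b mu + j + 1) alpha^b w_j.  The partial sums over n
   complete ARQ rounds have a closed form whose remainder is a combination of
   alpha^n and n alpha^n. *)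

(** * Limits, and series read along complete blocks *)

Lemma cvg_natr_expr (R : realType) (x : R) :
  0 <= x < 1 -> n%:R * x ^+ n @[n --> \oo] --> 0.
Proof.
move=> /andP[x0 x1].
(* The general term of a convergent series tends to 0; convergence follows from monotone bounded
   partial sums. *)
apply: (@cvg_series_cvg_0 R R^o (fun n => n%:R * x ^+ n)).
have x1' : 0 < 1 - x by rewrite subr_gt0.
apply: nondecreasing_is_cvgn.
  apply: nondecreasing_series => i _ _.
  by rewrite mulr_ge0// exprn_ge0.
(* The bound is the value of the full series; the identity below gives the exact deficit, which is
   nonnegative. *)
exists (x / (1 - x) ^+ 2) => _ [n _ <-].
rewrite ler_pdivlMr ?exprn_gt0//.
have -> : series (fun i => i%:R * x ^+ i) n * (1 - x) ^+ 2
    = x - x ^+ n * (n%:R * (1 - x) + x).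
  elim: n => [|n IH].
    by rewrite /series /= big_geq// expr0 !mul0r add0r mul1r subrr.
  by rewrite seriesSr mulrDl IH -(natr1 n) (exprS x n) /=; ring.
by rewrite gerBl mulr_ge0// ?exprn_ge0// addr_ge0// mulr_ge0// ltW.
Qed.

Lemma sum_blocks (R : nmodType) (mu : nat) (F : nat -> nat -> R) (n : nat) :
  (0 < mu)%N ->
  \sum_(0 <= q < n * mu) F (q %/ mu)%N (q %% mu)%N
  = \sum_(0 <= b < n) \sum_(0 <= j < mu) F b j.
Proof.
move=> mu0; rewrite big_nat_mul; apply: eq_bigr => b _.
rewrite -{1}[(b * mu)%N]add0n big_addn mulSn addnK.
apply: eq_big_nat => j /andP[_ jmu].
by rewrite addnC divnMDl// modnMDl divn_small// modn_small// addn0.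
Qed.

(** Nonnegative terms make the partial sums converge in the extended reals, so their limit can be
    read off along the multiples of [mu]. *)
Lemma nneseries_subseq_lim (R : realType) (u : nat -> R) (mu : nat) (l : R) :
  (0 < mu)%N -> (forall q, 0 <= u q) ->
  \sum_(0 <= q < n * mu) u q @[n --> \oo] --> l ->
  (\sum_(0 <= q <oo) (u q)%:E = l%:E)%E.
Proof.
move=> mu0 u0 ul.
have Su : cvgn (fun n => \sum_(0 <= q < n) (u q)%:E)%E.
  by apply: is_cvg_nneseries => q _ _; rewrite lee_fin.
apply: (@cvg_unique _ (@ereal_hausdorff R)
  (\sum_(0 <= q < n * mu) (u q)%:E @[n --> \oo])%E).
  exact: (cvg_comp _ _ (cvg_mulnr _ mu0) Su).
have -> : (fun n => \sum_(0 <= q < n * mu) (u q)%:E)%E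
    = EFin \o (fun n => \sum_(0 <= q < n * mu) u q).
  by apply/funext => n; rewrite /= sumEFin.
by apply: cvg_EFin => //; exact: nearW.
Qed.

(** * Total mass and mean of a block-geometric law *)

Section BlockGeometric.
Variables (R : realType) (x : R) (mu : nat) (w : nat -> R).
Hypotheses (x01 : 0 <= x < 1) (mu0 : (0 < mu)%N).
Hypothesis (w0 : forall j, (j < mu)%N -> 0 <= w j).
Hypothesis sum_w : \sum_(0 <= j < mu) w j = 1 - x.

Let u (q : nat) : R := x ^+ (q %/ mu) * w (q %% mu).

(** Block [b] has mass [x ^+ b * (1 - x)], so the first [n] blocks have mass [1 - x ^+ n]. *)
Lemma block_geometric_total : (\sum_(0 <= q <oo) (u q)%:E = 1%:E)%E.
Proof.
case/andP: (x01) => x0 x1.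
apply: (nneseries_subseq_lim _ _ _ _ mu0).
  by move=> q; rewrite mulr_ge0 ?exprn_ge0// w0// ltn_pmod.
have uE n : \sum_(0 <= q < n * mu) u q = 1 - x ^+ n.
  rewrite (sum_blocks _ _ (fun b j => x ^+ b * w j))//.
  under eq_bigr do rewrite -mulr_sumr sum_w.
  elim: n => [|n IH]; first by rewrite big_geq// expr0 subrr.
  by rewrite big_nat_recr//= IH (exprS x n); ring.
rewrite (_ : (fun n => _) = fun n => 1 - x ^+ n); last exact/funext.
have x_cvg0 : x ^+ n @[n --> \oo] --> 0 by apply: cvg_expr; rewrite ger0_norm.
by have := cvgB (cvg_cst (1 : R)) x_cvg0; rewrite subr0; apply.
Qed.

Lemma block_geometric_mean :
  (\sum_(0 <= q <oo) (q.+1%:R * u q)%:E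
   = ((\sum_(0 <= j < mu) w j * (j.+1%:R + (mu - j.+1)%:R * x))
      / (1 - x) ^+ 2)%:E)%E.
Proof.
case/andP: (x01) => x0 x1.
have x1' : 1 - x != 0 by rewrite subr_eq0 gt_eqF.
(* [B] is the contribution of block 0; [L] is the sum over b of
   [x ^+ b * (B + b%:R * mu%:R * (1 - x))]. *)
pose B := \sum_(0 <= j < mu) w j * j.+1%:R.
pose L := (B + mu%:R * x) / (1 - x).
have -> : (\sum_(0 <= j < mu) w j * (j.+1%:R + (mu - j.+1)%:R * x))
      / (1 - x) ^+ 2 = L.
  (* Each bracket equals [(1 - x) * j.+1%:R + mu%:R * x]; with [sum_w], one factor [1 - x] then
     cancels. *)
  have -> : \sum_(0 <= j < mu) w j * (j.+1%:R + (mu - j.+1)%:R * x)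
      = (1 - x) * B + mu%:R * x * \sum_(0 <= j < mu) w j.
    rewrite /B !mulr_sumr -big_split/=; apply: eq_big_nat => j /andP[_ jmu].
    by rewrite natrB//; ring.
  by rewrite sum_w /L; field.
apply: (nneseries_subseq_lim _ _ _ _ mu0).
  by move=> q; rewrite !mulr_ge0 ?exprn_ge0// w0// ltn_pmod.
have uE n : \sum_(0 <= q < n * mu) q.+1%:R * u q
    = L - L * x ^+ n - mu%:R * (n%:R * x ^+ n).
  pose F b j := (b * mu + j).+1%:R * (x ^+ b * w j).
  rewrite (eq_bigr (fun q => F (q %/ mu)%N (q %% mu)%N)); last first.
    by move=> q _; rewrite /F -divn_eq.
  rewrite sum_blocks//.
  have FE b : \sum_(0 <= j < mu) F b j
      = x ^+ b * (B + b%:R * mu%:R * (1 - x)).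
    rewrite -sum_w /B mulr_sumr -big_split/= mulr_sumr.
    by apply: eq_bigr => j _; rewrite /F -addnS natrD natrM; ring.
  under eq_bigr do rewrite FE.
  elim: n => [|n IH]; first by rewrite big_geq// expr0; ring.
  by rewrite big_nat_recr//= IH exprS -(natr1 n) /L; field.
rewrite (_ : (fun n => _)
  = fun n => L - L * x ^+ n - mu%:R * (n%:R * x ^+ n)); last exact/funext.
have x_cvg0 : x ^+ n @[n --> \oo] --> 0 by apply: cvg_expr; rewrite ger0_norm.
have nx_cvg0 := cvg_natr_expr R x x01.
have := cvgB (cvgB (cvg_cst L) (cvgM (cvg_cst L) x_cvg0))
  (cvgM (cvg_cst (mu%:R : R)) nx_cvg0).
by rewrite !mulr0 !subr0; apply.
Qed.

End BlockGeometric.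

(** * The number of transmissions as a random variable *)

Section FirstSuccess.
Variables (R : realType) (d : measure_display) (Omega : measurableType d).
Variables (P : probability Omega R) (D : nat -> set Omega).
Hypothesis mD : forall q, (0 < q)%N -> measurable (D q).

(** Shifted by one: transmissions are numbered from 1, series from 0. *)
Let A q := first_success D q.+1.

Lemma measurable_first_success q : measurable (A q).
Proof.
have -> : A q = D q.+1 `\` \bigcup_(i in `I_q) D i.+1.
  apply/seteqP; split => w [Dq H]; split => //.
    by move=> -[i /= iq]; apply: H; rewrite ltnS.
  by move=> [//|i] /andP[_ iq] Di; apply: H; exists i.
apply: measurableD; first exact: mD.
by apply: bigcup_measurable => i _; apply: mD.
Qed.

Lemma trivIset_first_success : trivIset setT A.
Proof.
apply/ltn_trivIset => j i ij; rewrite -subset0 => w [[Di _] [_ Hj]].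
exact: (Hj i.+1 ij Di).
Qed.

Lemma nb_transmissionsE q w : A q w -> nb_transmissions R D w = q.+1%:R%:E.
Proof.
move=> [Dq H]; apply/le_anti/andP; split.
  by apply: ereal_inf_lbound; exists q.+1.
apply: le_ereal_inf_tmp => _ [i [i0 Di] <-].
rewrite lee_fin ler_nat leqNgt; apply/negP => iq.
by apply: (H i) => //; rewrite i0.
Qed.

(** A least successful index would place [w] in some [A n]; hence no transmission succeeds, and the
    infimum of the empty set is [+oo]. *)
Lemma nb_transmissions_infty w :
  ~ (\bigcup_q A q) w -> nb_transmissions R D w = +oo%E.
Proof.
move=> nA.
rewrite /nb_transmissions (_ : [set _ | _ in _] = set0) ?ereal_inf0//.
rewrite -subset0 => y [q [q0 Dq] _]; apply: nA.
have ex : exists q, (0 < q)%N && `[< D q w >].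
  by exists q; rewrite q0; apply/asboolP.
have [[//|n] /andP[_ /asboolP Dn] nmin] := ex_minnP ex.
exists n => //; split => // i /andP[i0 iq] Di.
have := nmin i; rewrite i0 (asboolT Di) => /(_ isT).
by rewrite leqNgt iq.
Qed.

(** The function is constant on each [A q] and on the complement of their union, and these
    measurable pieces cover the space. *)
Lemma measurable_nb_transmissions :
  measurable_fun setT (nb_transmissions R D : Omega -> \bar R).
Proof.
have mA := measurable_first_success.
have mU : measurable (\bigcup_q A q) by exact: bigcup_measurable.
rewrite -(setUv (\bigcup_q A q)); apply/measurable_funU => //.
  exact: measurableC.
split.
  apply/measurable_fun_bigcup => // q.
  apply: (@eq_measurable_fun _ _ _ _ _ (cst q.+1%:R%:E)) => [w|].
    by rewrite inE => /(nb_transmissionsE _ _) ->.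
  exact: measurable_cst.
apply: (@eq_measurable_fun _ _ _ _ _ (cst +oo%E)) => [w|].
  by rewrite inE => /(nb_transmissions_infty _) ->.
exact: measurable_cst.
Qed.

(** Total mass 1 makes the set where the integrand may be infinite negligible; the integral then
    splits over the disjoint [A q]. *)
Lemma expectation_nb_transmissions (a : R) : 0 <= a ->
  (\sum_(0 <= q <oo) P (A q) = 1)%E ->
  (\int[P]_w (a%:E * nb_transmissions R D w)
   = \sum_(0 <= q <oo) ((a * q.+1%:R)%:E * P (A q)))%E.
Proof.
move=> a0 PA.
have mA := measurable_first_success.
have mU : measurable (\bigcup_q A q) by exact: bigcup_measurable.
have N0 w : (0 <= a%:E * nb_transmissions R D w)%E.
  apply: mule_ge0 => //; apply: le_ereal_inf_tmp => _ [q _ <-].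
  by rewrite lee_fin.
have mN : measurable_fun setT (fun w => a%:E * nb_transmissions R D w)%E.
  apply: emeasurable_funM; first exact: measurable_cst.
  exact: measurable_nb_transmissions.
rewrite (@ge0_negligible_integral _ _ _ _ _ (~` \bigcup_q A q))//; first last.
- rewrite [LHS]probability_setC//= measure_semi_bigcup// ?PA ?subee//.
  exact: trivIset_first_success.
- exact: measurableC.
rewrite setTD setCK ge0_integral_bigcup//; first last.
- exact: trivIset_first_success.
- exact: measurable_funTS.
apply: eq_eseriesr => q _; rewrite -integral_cst//.
by apply: eq_integral => w; rewrite inE => /(nb_transmissionsE _ _) ->.
Qed.

End FirstSuccess.

(** * Success and failure probabilities within one ARQ round *)

Section RoundWeights.
Variables (R : realType) (Pe : nat -> R) (Lf mu : nat).
Hypotheses (Lf0 : (0 < Lf)%N) (mu0 : (0 < mu)%N).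
Hypothesis Pe01 : forall J, (1 <= J <= mu)%N -> 0 < Pe J < 1.

Lemma p_corr_itv J : (1 <= J <= mu)%N -> 0 < p_corr Pe Lf J < 1.
Proof.
move=> /Pe01 /andP[Pe0 Pe1]; rewrite /p_corr exprn_gt0 ?subr_gt0//=.
by rewrite exprn_ilt1 ?subr_ge0 1?ltW// -?lt0n// gtrBl.
Qed.

Lemma p_err_itv J : (1 <= J <= mu)%N -> 0 < p_err Pe Lf J < 1.
Proof.
move=> Jmu; have /andP[c0 c1] := p_corr_itv J Jmu.
by case: J Jmu c0 c1 => // J _ c0 c1; rewrite /p_err subr_gt0 c1 gtrBl.
Qed.

Lemma arq_fail_itv : 0 <= arq_fail Pe Lf mu < 1.
Proof.
rewrite /arq_fail big_nat_cond prodr_ge0/=; last first.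
  by move=> J; rewrite andbT ltnS => /p_err_itv /andP[/ltW].
rewrite -big_nat_cond big_ltn//.
have /andP[e0 e1] : 0 < p_err Pe Lf 1 < 1 by exact: p_err_itv.
(* The first factor, present since [mu] is positive, is strictly below 1; the others are at most
   1. *)
apply: le_lt_trans e1; rewrite ger_pMr// big_nat_cond.
apply: prodr_ile1 => J /andP[/andP[J2 Jmu] _].
have /p_err_itv /andP[/ltW -> /ltW ->] // : (1 <= J <= mu)%N.
by rewrite (ltnW J2).
Qed.

Lemma round_weightE j :
  round_weight Pe Lf j.+1
  = (\prod_(1 <= J < j.+1) p_err Pe Lf J) * p_corr Pe Lf j.+1.
Proof.
rewrite /round_weight; congr (_ * _).
(* Reversing the product puts the factor [p_err 0 = 1] first, where it drops out. *)
rewrite big_nat_rev/= big_nat_recl// subSS subnn mul1r.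
apply: eq_big_nat => i /andP[_ ij].
by rewrite add1n !subSS subKn// ltnW.
Qed.

Lemma round_weight_ge0 j : (j < mu)%N -> 0 <= round_weight Pe Lf j.+1.
Proof.
move=> jmu; rewrite round_weightE mulr_ge0//; last first.
  by have /andP[/ltW] := p_corr_itv j.+1 jmu.
rewrite big_nat_cond prodr_ge0// => J /andP[/andP[J1 Jj] _].
have /p_err_itv /andP[/ltW] // : (1 <= J <= mu)%N.
by rewrite J1 (leq_trans _ jmu) // ltnW.
Qed.

(** Since [p_corr] is [1 - p_err] at positive indices, each weight is the drop between consecutive
    failure products, and the sum telescopes. *)
Lemma sum_round_weight :
  \sum_(0 <= j < mu) round_weight Pe Lf j.+1 = 1 - arq_fail Pe Lf mu.
Proof.
pose Q j := - \prod_(1 <= J < j.+1) p_err Pe Lf J.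
rewrite (@telescope_sumr_eq _ 0 mu Q)// => [|j _].
  by rewrite /Q [X in _ - - X]big_geq// opprK addrC.
by rewrite round_weightE /Q [X in _ = - X - _]big_nat_recr//=; ring.
Qed.

End RoundWeights.

Theorem proposition3 (R : realType) (d : measure_display)
    (Omega : measurableType d) (P : probability Omega R)
    (H : Omega -> complex R) (D : nat -> set Omega) (Pe : nat -> R)
    (k Lf mu : nat) (tau N0 c g : R)
    (hk : (1 <= k)%N) (hLf : (1 <= Lf)%N) (hmu : (1 <= mu)%N)
    (htau : 0 <= tau) (hN0 : 0 < N0) (hc : 0 < c) (hg : 0 < g)
    (hH : std_complex_gaussian P H)
    (hPe : forall J : nat, (1 <= J <= mu)%N ->
       Pe J = bit_error_prob tau N0 c g J)
    (hPe01 : forall J : nat, (1 <= J <= mu)%N -> 0 < Pe J < 1)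
    (hD : decoding_process P Pe Lf mu D) :
  let m := selective_prob P H tau in
  let alpha := arq_fail Pe Lf mu in
  throughput P k m D =
    ((1 - alpha) ^+ 2 /
     ((1 + m) * \sum_(1 <= J < mu.+1)
        (\prod_(1 <= j < J.+1) p_err Pe Lf (J - j)) * p_corr Pe Lf J
        * (J%:R + (mu - J)%:R * alpha)))%:E.
Proof.
move=> m alpha; case: hD => mD PD.
have alpha01 : 0 <= alpha < 1 by exact: arq_fail_itv.
have [alpha0 alpha1] := andP alpha01.
have m0 : 0 <= m by rewrite /m /selective_prob fine_ge0.
pose w j := round_weight Pe Lf j.+1.
have w0 j : (j < mu)%N -> 0 <= w j by exact: round_weight_ge0.
have sum_w : \sum_(0 <= j < mu) w j = 1 - alpha by exact: sum_round_weight.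
pose u q := alpha ^+ (q %/ mu) * w (q %% mu)%N.
have Pu q : P (first_success D q.+1) = (u q)%:E.
  by rewrite PD// /first_success_prob subn1.
have u0 q : 0 <= u q.
  by rewrite -lee_fin -Pu measure_ge0.
have a0 : 0 < k%:R * (1 + m) by rewrite mulr_gt0 ?ltr0n ?ltr_wpDr.
(* Reindexing by J = j + 1 matches the sum in [block_geometric_mean]. *)
rewrite big_add1/= -/alpha.
set S := \sum_(0 <= i < mu) _.
(* Every bracket is at least 1, so [S] dominates the sum of the weights, [1 - alpha]. Positivity
   keeps the expected bit count away from 0. *)
have S0 : 0 < S.
  apply: (@lt_le_trans _ _ (1 - alpha)); first by rewrite subr_gt0.
  rewrite -sum_w; apply: ler_sum_nat => j /andP[_ jmu].
  by rewrite ler_peMr ?w0// -[leLHS]addr0 lerD ?ler1n// mulr_ge0.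
have EN : expected_bits P k m D
    = (k%:R * (1 + m) * (S / (1 - alpha) ^+ 2))%:E.
  rewrite /expected_bits (expectation_nb_transmissions _ _ _ _ _ mD) ?ltW//.
    rewrite EFinM -(block_geometric_mean _ _ _ _ alpha01 hmu w0 sum_w).
    rewrite -nneseriesZl; last first.
      by move=> q _; rewrite lee_fin; exact: mulr_ge0 (ler0n _ _) (u0 q).
    apply: eq_eseriesr => q _; rewrite Pu -!EFinM; congr EFin.
    exact/esym/mulrA.
  (* Remaining condition: decoding eventually succeeds with probability one. *)
  under eq_eseriesr do rewrite Pu.
  exact: (block_geometric_total _ _ _ _ alpha01 hmu w0 sum_w).
(* The extended-real inverse treats 0 separately; that case is excluded by [a0] and [S0]. *)
rewrite /throughput EN inver ifF; last first.
  by rewrite gt_eqF// mulr_gt0// divr_gt0// exprn_gt0// subr_gt0.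
rewrite -EFinM; congr EFin; field.
by rewrite !gt_eqF// ?ltr0n ?subr_gt0 ?ltr_wpDr.
Qed.
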